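(* Let $\lambda$ be a partition of $n$. There exists a basis $\{v_T\}$ of $V^\lambda$, indexed by the standard Young tableaux $T$ of shape $\lambda$, in which the Coxeter generators $s_i=(i\ \,i+1)$, $i=1,\dots,n-1$, act according to the following formulas: if $T$ and $T'=s_iT$ are standard tableaux of shape $\lambda$ with $\ell(T')>\ell(T)$, and $(a_1,\dots,a_n)$ is the sequence of contents of the boxes of $T$ ($a_j$ is the content of the box of $T$ containing $j$), then $$s_i\cdot v_T=v_{T'}+\frac1{a_{i+1}-a_i}\,v_T,\qquad s_i\cdot v_{T'}=\Bigl(1-\frac1{(a_{i+1}-a_i)^2}\Bigr)v_T-\frac1{a_{i+1}-a_i}\,v_{T'} .$$ All irreducible representations of $S_n$ are defined over the field $\mathbb{Q}$.
   Context: Representations are over $\mathbb{C}$. The content of a box of a Young diagram is its column index minus its row index. For a partition $\lambda$ of $n$, $V^\lambda$ denotes the irreducible $S_n$-module having a basis indexed by the standard Young tableaux $T$ of shape $\lambda$ and consisting of common eigenvectors of the elements $X_j=(1\,j)+(2\,j)+\dots+(j-1\ \,j)$, $j=1,\dots,n$ (with $X_1=0$), where the eigenvalue of $X_j$ on the vector indexed by $T$ is the content of the box of $T$ containing $j$. Every irreducible $S_n$-module is isomorphic to $V^\lambda$ for a unique $\lambda$. $s_iT$ denotes the tableau obtained from $T$ by exchanging the numbers $i$ and $i+1$. $T^\lambda$ is the tableau of shape $\lambda$ filled with $1,2,\dots,n$ row by row (left to right, top to bottom). For a standard tableau $T$ of shape $\lambda$, $\ell(T)=\ell(s)$ is the number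 of inversions of the permutation $s\in S_n$ that maps $T^\lambda$ to $T$, i.e. that sends the number in each box of $T^\lambda$ to the number in the same box of $T$. *)

(* Defs.v *)
From mathcomp Require Import all_boot all_order all_algebra all_fingroup.
From mathcomp Require Import mxrepresentation reals complex.

Set Implicit Arguments.
Unset Strict Implicit.
Unset Printing Implicit Defensive.

Import Order.TTheory GRing.Theory Num.Theory.

Local Open Scope nat_scope.

Definition is_part (n : nat) (sh : seq nat) : bool :=
  [&& sorted geq sh, 0 \notin sh & sumn sh == n].

Record partition_of (n : nat) := PartitionOf {
  parts :> seq nat;
  partsP : is_part n parts
}.

Lemma sumn_parts n (lam : partition_of n) : sumn lam = n.
Proof. by case/and3P: (partsP lam) => _ _ /eqP. Qed.

(* The boxes (r, c) with c < lam_r; both indices start at 0. *)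
Definition box n (lam : partition_of n) : finType :=
  {r : 'I_(size lam) & 'I_(nth 0 lam r)}%type.

Section Boxes.
Variables (n : nat) (lam : partition_of n).
Implicit Types (b : box lam) (T : {ffun box lam -> 'I_n}).

Definition brow b : nat := tag b.
Definition bcol b : nat := tagged b.

Definition content b : int := ((bcol b)%:Z - (brow b)%:Z)%R.

Lemma bcol_lt b : bcol b < nth 0 lam (brow b).
Proof. exact: ltn_ord. Qed.

Lemma box_inj b1 b2 : brow b1 = brow b2 -> bcol b1 = bcol b2 -> b1 = b2.
Proof.
case: b1 b2 => [r1 c1] [r2 c2]; rewrite /brow /bcol /= => /val_inj Er.
by case: r2 / Er c2 => c2 /val_inj ->.
Qed.

(* Injectivity is enough for each of the n numbers to occur exactly once,
   as there are n boxes: see card_box below. *)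
Definition is_standard T : bool :=
  [&& injectiveb T,
      [forall b1, forall b2,
         (brow b1 == brow b2) && (bcol b1 < bcol b2) ==> (T b1 < T b2)]
    & [forall b1, forall b2,
         (bcol b1 == bcol b2) && (brow b1 < brow b2) ==> (T b1 < T b2)]].

Definition stdtab := {T : {ffun box lam -> 'I_n} | is_standard T}.

Lemma row_fill_lt b : flatten_index lam (brow b) (bcol b) < n.
Proof. by rewrite -[X in _ < X](sumn_parts lam) flatten_indexP ?bcol_lt. Qed.

(* flatten_index lam r c = lam_0 + ... + lam_(r-1) + c *)
Definition row_fill : {ffun box lam -> 'I_n} :=
  [ffun b => Ordinal (row_fill_lt b)].

Lemma row_fill_inj : injective row_fill.
Proof.
move=> b1 b2; rewrite !ffunE => /(congr1 val) /= E; apply: box_inj.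
  by rewrite -(flatten_indexKl (bcol_lt b1)) E flatten_indexKl ?bcol_lt.
by rewrite -(flatten_indexKr (bcol_lt b1)) E flatten_indexKr ?bcol_lt.
Qed.

Lemma row_fill_onto (k : 'I_n) : exists b, row_fill b = k.
Proof.
have ltk : k < sumn lam by rewrite sumn_parts.
exists (Tagged (fun r : 'I_(size lam) => 'I_(nth 0 lam r))
  (Ordinal (reshape_offsetP ltk) : 'I_(nth 0 lam (Ordinal (reshape_indexP ltk))))).
by apply: val_inj; rewrite ffunE /= reshape_indexK.
Qed.

Lemma card_box : #|box lam| = n.
Proof.
rewrite -(card_codom row_fill_inj) -[RHS]card_ord; apply: eq_card => k.
by have [b <-] := row_fill_onto k; rewrite codom_f.
Qed.

Lemma row_fill_standard : is_standard row_fill.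
Proof.
apply/and3P; split.
- exact/injectiveP/row_fill_inj.
- apply/'forall_forallP => b1 b2; apply/implyP => /andP[/eqP Er lt_c].
  by rewrite !ffunE /= /flatten_index Er ltn_add2l.
apply/'forall_forallP => b1 b2; apply/implyP => /andP[/eqP Ec lt_r].
rewrite !ffunE /= /flatten_index Ec ltn_add2r.
have lt_sz : brow b1 < size lam by exact: ltn_ord.
have pos_row : 0 < nth 0 lam (brow b1) by exact: leq_ltn_trans (bcol_lt b1).
rewrite -(subnKC lt_r) takeD sumn_cat (take_nth 0) // sumn_rcons.
by rewrite -addnA -[X in X < _]addn0 ltn_add2l ltn_addr.
Qed.

Definition row_tab : stdtab := exist _ row_fill row_fill_standard.

Lemma stdtab_inj (T : stdtab) : injective (val T).
Proof. by case/and3P: (valP T) => /injectiveP. Qed.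

Lemma stdtab_codom (T : stdtab) (k : 'I_n) : k \in codom (val T).
Proof. by rewrite inj_card_onto ?card_box ?card_ord //; exact: stdtab_inj. Qed.

Definition box_of (T : stdtab) (k : 'I_n) : box lam := iinv (stdtab_codom T k).

Lemma box_ofK (T : stdtab) : cancel (box_of T) (val T).
Proof. by move=> k; exact: f_iinv. Qed.

Lemma stdtabK (T : stdtab) : cancel (val T) (box_of T).
Proof. by move=> b; apply: (stdtab_inj (T := T)); rewrite box_ofK. Qed.

Lemma tab_perm_inj (T : stdtab) :
  injective (fun k : 'I_n => val T (box_of row_tab k)).
Proof. by move=> k1 k2 /stdtab_inj /(can_inj (box_ofK row_tab)). Qed.

Definition tab_perm (T : stdtab) : 'S_n := perm (tab_perm_inj (T := T)).

Lemma tab_permE (T : stdtab) b : tab_perm T (val row_tab b) = val T b.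
Proof. by rewrite permE stdtabK. Qed.

Definition inversions (s : 'S_n) : nat :=
  #|[set p : 'I_n * 'I_n | (p.1 < p.2) && (s p.2 < s p.1)]|.

Definition tab_length (T : stdtab) : nat := inversions (tab_perm T).

Definition tab_content (T : stdtab) (k : 'I_n) : int := content (box_of T k).

Definition swap_fill (i j : 'I_n) T : {ffun box lam -> 'I_n} :=
  [ffun b => tperm i j (T b)].

End Boxes.

Section Modules.
Variables (F : fieldType) (n d : nat).
Variable rG : mx_representation F [set: 'S_n] d.

(* The module is the space of row vectors, on which g acts by v |-> v *m rG g.
   Since (g * h) x = h (g x) in 'S_n, this is a left action of the symmetric
   group for the usual composition of permutations. *)
Definition sn_act (g : 'S_n) (v : 'rV[F]_d) : 'rV[F]_d := (v *m rG g)%R.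

Definition sn_act_JM (j : 'I_n) (v : 'rV[F]_d) : 'rV[F]_d :=
  (\sum_(k < n | (k < j)%N) sn_act (tperm k j) v)%R.

Definition tab_basis (lam : partition_of n) (v : stdtab lam -> 'rV[F]_d) : Prop :=
  basis_of fullv (codom v).

(* rG affords the module V^lam *)
Definition is_V (lam : partition_of n) : Prop :=
  mx_irreducible rG /\
  exists w : stdtab lam -> 'rV[F]_d,
    tab_basis w /\
    forall (T : stdtab lam) (j : 'I_n),
      sn_act_JM j (w T) = ((tab_content T j)%:~R *: w T)%R.

End Modules.

Definition defined_over_rat (F : numFieldType) (n d : nat)
    (rG : mx_representation F [set: 'S_n] d) : Prop :=
  exists rQ : mx_representation rat [set: 'S_n] d,
    mx_rsim rG (map_repr (ratr : {rmorphism rat -> F}) rQ).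

(* Main.v *)
Require Import Defs.
From mathcomp Require Import all_boot all_order all_algebra all_fingroup.
From mathcomp Require Import mxrepresentation reals complex.
From mathcomp Require Import spectral zify ring.

(* Let X_k be the Jucys-Murphy elements and s = (i j) with j = i+1.  For an
   averaged invariant Hermitian form, s and the X_k are self-adjoint.  A common
   eigenvector v with eigenvalues a satisfies a_i <> a_j, and with r = a_j - a_i
   the vector u = s v - v/r has eigenvalues a o s.  If r = 1 or r = -1 then u is
   orthogonal to itself, so s v = r v; otherwise u <> 0, and by induction on k
   all eigenvalues of X_k are integers.
   Start from any common eigenvector w0, with eigenvalues a, and call a
   permutation admissible if it keeps the order of any two positions whose
   a-values differ by 0, 1 or -1.  Going up through admissible permutations one
   inversion at a time, the vectors u give
     v_t = t w0 + (a combination of t' w0 with t' of fewer inversions)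
   with eigenvalues a o t^-1.  These eigenvalues determine t, and eigenvectors
   with distinct eigenvalues are orthogonal, so v_t does not depend on the path.
   The v_t span a submodule on which adjacent transpositions have rational
   matrices; hence rationality, with no need to recognize tableaux in a.  If a
   is the content sequence of T^lambda, the permutation of a standard tableau is
   admissible, and these v_t form the seminormal basis. *)

Set Implicit Arguments.
Unset Strict Implicit.
Unset Printing Implicit Defensive.

Import Order.TTheory GRing.Theory Num.Theory.

Local Open Scope ring_scope.

(** * Inversions and adjacent transpositions *)

Section AdjacentTranspositions.

Variable n : nat.
Implicit Types (s : 'S_n) (i j k : 'I_n).

Lemma tperm_adj_ltn i j k l : j = i.+1 :> nat ->
    (k, l) != (i, j) -> (k, l) != (j, i) ->
  (tperm i j k < tperm i j l)%N = (k < l)%N.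
Proof.
rewrite !xpair_eqE -!val_eqE /= => ji.
by case: tpermP => [->|->|/eqP+ /eqP+]; case: tpermP => [->|->|/eqP+ /eqP+];
  rewrite -?val_eqE /=; lia.
Qed.

(** In [s * tperm i j] the factor [s] acts first, so the values [i] and [j] trade places and only
    the pair of their positions changes order. *)
Lemma inversions_mul_adj s i j : j = i.+1 :> nat ->
    (s^-1%g i < s^-1%g j)%N ->
  inversions (s * tperm i j)%g = (inversions s).+1.
Proof.
move=> ji lt_ij; rewrite /inversions.
set I := [set p | _ & s p.2 < s p.1]%N.
have notI: (s^-1%g i, s^-1%g j) \notin I by rewrite inE !permKV ji /=; lia.
have <-: #|(s^-1%g i, s^-1%g j) |: I| = #|I|.+1 by rewrite cardsU1 notI.
congr #|pred_of_set _|; apply/setP=> -[k l].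
rewrite !inE /= !permM xpair_eqE.
rewrite -(inj_eq (@perm_inj _ s) k) -(inj_eq (@perm_inj _ s) l) !permKV.
have [/andP[/eqP sk /eqP sl]|neq1] := boolP ((s k == i) && (s l == j)).
  have [-> ->]: k = s^-1%g i /\ l = s^-1%g j by rewrite -sk -sl !permK.
  by rewrite !permKV tpermL tpermR lt_ij ji ltnS leqnn.
have [/andP[/eqP sk /eqP sl]|neq2] := boolP ((s k == j) && (s l == i)).
  have [-> ->]: k = s^-1%g j /\ l = s^-1%g i by rewrite -sk -sl !permK.
  by rewrite !permKV tpermL tpermR; lia.
by rewrite orFb tperm_adj_ltn // xpair_eqE andbC.
Qed.

(** Without such a pair [s^-1] is increasing, and inductions from the two ends of the range give
    [k <= s^-1 k] and [s^-1 k <= k]. *)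
Lemma perm_descent s : s != 1%g ->
  exists i j, j = i.+1 :> nat /\ (s^-1%g j < s^-1%g i)%N.
Proof.
move=> s_neq1; have [/'exists_existsP[i [j /andP[/eqP ji lt_ji]]]|noD] :=
  boolP [exists i : 'I_n, exists j : 'I_n,
           (val j == i.+1) && (s^-1%g j < s^-1%g i)%N].
  by exists i, j.
have asc i j: j = i.+1 :> nat -> (s^-1%g i < s^-1%g j)%N.
  move=> ji; move: noD; rewrite negb_exists => /forallP/(_ i).
  rewrite negb_exists => /forallP/(_ j).
  rewrite [_ == _](introT eqP ji) -leqNgt.
  rewrite leq_eqVlt => /orP[/eqP/val_inj/perm_inj ij|//].
  by move: ji; rewrite ij; lia.
have ge m (k : 'I_n) : k = m :> nat -> (k <= s^-1%g k)%N.
  elim: m k => [|m IHm] k km; first by rewrite km.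
  have lt_mn: (m < n)%N by have := ltn_ord k; lia.
  have := IHm (Ordinal lt_mn) erefl; have /= := asc (Ordinal lt_mn) k km; lia.
have le m (k : 'I_n) : (k + m.+1)%N = n -> (s^-1%g k <= k)%N.
  elim: m k => [|m IHm] k km; first by have := ltn_ord (s^-1%g k); lia.
  have lt_kn: (k.+1 < n)%N by lia.
  have /= := IHm (Ordinal lt_kn); have := asc k (Ordinal lt_kn) erefl; lia.
case/eqP: s_neq1; apply/permP=> k; rewrite perm1; apply: (@perm_inj _ s^-1%g).
rewrite permK; apply/val_inj/eqP.
rewrite eqn_leq (ge k k) //= (le (n - k.+1)%N) //.
by have := ltn_ord k; lia.
Qed.

Lemma perm_ascent_split s : s != 1%g ->
  exists s' i j, [/\ j = i.+1 :> nat, (s'^-1%g i < s'^-1%g j)%N,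
    s = (s' * tperm i j)%g & inversions s = (inversions s').+1].
Proof.
move=> /perm_descent[i [j [ji lt_ji]]].
have asc: ((s * tperm i j)^-1%g i < (s * tperm i j)^-1%g j)%N.
  by rewrite invMg tpermV !permM tpermL tpermR.
exists (s * tperm i j)%g, i, j; split=> //.
  by rewrite -mulgA tperm2 mulg1.
by rewrite -(inversions_mul_adj ji asc) -mulgA tperm2 mulg1.
Qed.

Lemma inversions_mul_adj_le s i j : j = i.+1 :> nat ->
  (inversions (s * tperm i j)%g <= (inversions s).+1)%N.
Proof.
move=> ji; have [lt_ij|lt_ji|/val_inj/perm_inj ij] :=
  ltngtP (s^-1%g i) (s^-1%g j).
- by rewrite inversions_mul_adj.
- suff <-: (inversions (s * tperm i j)%g).+1 = inversions s by lia.
  rewrite -(inversions_mul_adj ji) -?mulgA ?tperm2 ?mulg1 //.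
  by rewrite invMg tpermV !permM tpermL tpermR.
by move: ji; rewrite ij; lia.
Qed.

Lemma inversions1 : inversions (1%g : 'S_n) = 0%N.
Proof.
apply/eqP; rewrite cards_eq0; apply/eqP/setP=> -[k l].
by rewrite !inE !perm1 /=; lia.
Qed.

Lemma adj_ind (P : 'S_n -> Prop) : P 1%g ->
    (forall s i j, j = i.+1 :> nat -> P s -> P (s * tperm i j)%g) ->
  forall s, P s.
Proof.
move=> P1 PM s; have [m] := ubnP (inversions s).
elim: m s => // m IHm s lt_s.
have [->//|/perm_ascent_split[s' [i [j [ji _ s_def inv_s]]]]] := eqVneq s 1%g.
by rewrite s_def; apply: PM => //; apply: IHm; lia.
Qed.

End AdjacentTranspositions.

(** * The averaged invariant Hermitian form *)

Section WeightVectors.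

Variables (C : numClosedFieldType) (n d : nat).
Variable rG : mx_representation C [set: 'S_n] d.
Implicit Types (u v : 'rV[C]_d) (g s t : 'S_n) (i j k l : 'I_n).
Implicit Types (a b : 'I_n -> C).

Lemma sn_repr_mxM g h : rG (g * h)%g = rG g *m rG h.
Proof. by rewrite repr_mxM ?inE. Qed.

Lemma sn_repr_tpermK i j : rG (tperm i j) *m rG (tperm i j) = 1%:M.
Proof. by rewrite -sn_repr_mxM tperm2 repr_mx1. Qed.

Definition hform u v : C :=
  \sum_(g : 'S_n) \sum_k (u *m rG g) 0 k * ((v *m rG g) 0 k)^*.

Lemma hformDl u1 u2 v : hform (u1 + u2) v = hform u1 v + hform u2 v.
Proof.
rewrite -big_split; apply: eq_bigr => g _; rewrite -big_split.
by apply: eq_bigr => k _; rewrite mulmxDl mxE mulrDl.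
Qed.

Lemma hformZl c u v : hform (c *: u) v = c * hform u v.
Proof.
rewrite mulr_sumr; apply: eq_bigr => g _; rewrite mulr_sumr.
by apply: eq_bigr => k _; rewrite -scalemxAl mxE mulrA.
Qed.

Lemma hform0l v : hform 0 v = 0.
Proof. by rewrite -(scale0r (0 : 'rV_d)) hformZl mul0r. Qed.

Lemma hformBl u1 u2 v : hform (u1 - u2) v = hform u1 v - hform u2 v.
Proof. by rewrite -scaleN1r hformDl hformZl mulN1r. Qed.

Lemma hform_suml (I : finType) (P : pred I) (x : I -> 'rV[C]_d) v :
  hform (\sum_(i | P i) x i) v = \sum_(i | P i) hform (x i) v.
Proof.
apply: (big_morph (fun u => hform u v)); last exact: hform0l.
by move=> u1 u2; apply: hformDl.
Qed.

Lemma hform_conj u v : (hform u v)^* = hform v u.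
Proof.
rewrite rmorph_sum; apply: eq_bigr => g _; rewrite rmorph_sum.
by apply: eq_bigr => k _; rewrite rmorphM /= conjCK mulrC.
Qed.

Lemma hformZr c u v : hform u (c *: v) = c^* * hform u v.
Proof. by rewrite -hform_conj hformZl rmorphM /= hform_conj. Qed.

Lemma hform_sumr (I : finType) (P : pred I) (x : I -> 'rV[C]_d) u :
  hform u (\sum_(i | P i) x i) = \sum_(i | P i) hform u (x i).
Proof.
rewrite -hform_conj hform_suml rmorph_sum; apply: eq_bigr => i _.
exact: hform_conj.
Qed.

Lemma hform_eq0 u : hform u u = 0 -> u = 0.
Proof.
have ge0 g : 0 <= \sum_k (u *m rG g) 0 k * ((u *m rG g) 0 k)^*.
  by apply: sumr_ge0 => k _; apply: mul_conjC_ge0.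
move/eqP; rewrite /hform psumr_eq0 // => /allP/(_ 1%g).
rewrite mem_index_enum => /(_ isT)/=; rewrite psumr_eq0; last first.
  by move=> k _; apply: mul_conjC_ge0.
move/allP => eq0; apply/rowP=> k; apply/eqP; rewrite mxE -mul_conjC_eq0.
by have /= := eq0 k (mem_index_enum k); rewrite repr_mx1 mulmx1.
Qed.

Lemma hform_inv g u v : hform (u *m rG g) (v *m rG g) = hform u v.
Proof.
rewrite [RHS](reindex_inj (mulgI g)) /=.
by apply: eq_bigr => h _; rewrite sn_repr_mxM !mulmxA.
Qed.

Lemma hform_tperm i j u v :
  hform (u *m rG (tperm i j)) v = hform u (v *m rG (tperm i j)).
Proof. by rewrite -(hform_inv (tperm i j)) -mulmxA sn_repr_tpermK mulmx1. Qed.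

(** * Commutation relations of the Jucys-Murphy elements *)

Definition jmx k : 'M[C]_d := \sum_(l < n | (l < k)%N) rG (tperm l k).

Lemma sn_act_JME k v : sn_act_JM rG k v = v *m jmx k.
Proof. by rewrite mulmx_sumr. Qed.

Lemma hform_jmx k u v : hform (u *m jmx k) v = hform u (v *m jmx k).
Proof.
rewrite !mulmx_sumr hform_suml hform_sumr.
by apply: eq_bigr => l _; apply: hform_tperm.
Qed.

(** Conjugation by such a [g] permutes the summands of X_k. *)
Lemma jmx_comm g k : g k = k -> (forall l : 'I_n, (g l < k) = (l < k))%N ->
  rG g *m jmx k = jmx k *m rG g.
Proof.
move=> gk lt_g; rewrite mulmx_sumr mulmx_suml.
rewrite (reindex_inj (@perm_inj _ g)) /=; apply: eq_big => l; first exact: lt_g.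
move=> _; rewrite -!sn_repr_mxM; congr (rG _).
by rewrite -{1}gk -tpermJ [RHS]conjgC.
Qed.

Lemma jmx_tperm_comm k l (m : 'I_n) : (k < m)%N -> (l < m)%N ->
  rG (tperm k l) *m jmx m = jmx m *m rG (tperm k l).
Proof.
move=> km lm; apply: jmx_comm.
  by rewrite tpermD // -val_eqE /=; lia.
by move=> p; case: tpermP => [->|->|//]; rewrite km lm.
Qed.

Lemma jmx_commC k (m : 'I_n) : jmx k *m jmx m = jmx m *m jmx k.
Proof.
wlog lt_km: k m / (k < m)%N.
  by move=> IH; have [/IH//|/IH//|/val_inj->] := ltngtP k m.
apply/esym; rewrite mulmx_sumr mulmx_suml; apply: eq_bigr => l lk.
by apply/esym; apply: jmx_tperm_comm => //; lia.
Qed.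

Lemma jmx_comm_adj i j k : j = i.+1 :> nat -> k != i -> k != j ->
  rG (tperm i j) *m jmx k = jmx k *m rG (tperm i j).
Proof.
rewrite -!val_eqE /= => ji ki kj; apply: jmx_comm.
  by rewrite tpermD // -val_eqE /=; lia.
by move=> l; case: tpermP => [->|->|//]; lia.
Qed.

(** With s = (i j), this is X_j = s X_i s + s multiplied by s: conjugation turns each (l i) with l <
    i into (l j), and the extra summand s of X_j squares to 1. *)
Lemma jmx_adj i j : j = i.+1 :> nat ->
  rG (tperm i j) *m jmx i = jmx j *m rG (tperm i j) - 1%:M.
Proof.
move=> ji; rewrite /jmx (bigD1 (P := fun l => (l < j)%N) i) /=; last by lia.
rewrite mulmxDl sn_repr_tpermK addrC addKr mulmx_sumr mulmx_suml.
apply: eq_big => l; first by rewrite -val_eqE /= ji; lia.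
move=> lt_li; rewrite -!sn_repr_mxM; congr (rG _); rewrite [RHS]conjgC tpermJ.
by rewrite tpermR tpermD // -val_eqE /=; lia.
Qed.

Lemma jmx_adj_succ i j : j = i.+1 :> nat ->
  rG (tperm i j) *m jmx j = jmx i *m rG (tperm i j) + 1%:M.
Proof.
move=> ji; have /(congr1 (fun A => rG (tperm i j) *m A *m rG (tperm i j))) :=
  jmx_adj ji.
rewrite mulmxBr mulmx1 mulmxBl sn_repr_tpermK !mulmxA sn_repr_tpermK mul1mx.
move=> ->.
by rewrite subrK -!mulmxA sn_repr_tpermK mulmx1.
Qed.

(** * Common eigenvectors and intertwining vectors *)

Definition weight a v := forall k, v *m jmx k = a k *: v.

Lemma weight_real a v k : weight a v -> v != 0 -> (a k)^* = a k.
Proof.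
move=> av v0; have := hform_jmx k v v; rewrite av hformZl hformZr => /esym.
by apply: mulIf; apply: contraNneq v0 => /hform_eq0->.
Qed.

Lemma weight_orth a b u v k : weight a u -> weight b v -> a k != b k ->
  hform u v = 0.
Proof.
move=> au bv ab; have [->|v0] := eqVneq v 0.
  by rewrite -hform_conj hform0l rmorph0.
have := hform_jmx k u v; rewrite au bv hformZl hformZr (weight_real _ bv v0).
move/eqP; rewrite -subr_eq0 -mulrBl mulf_eq0 subr_eq0 (negPf ab) /=.
by move/eqP.
Qed.

(** With s = (i j), computing <v s X_i, v> in two ways gives a_j <v s, v> - <v, v> = a_i <v s, v>,
    so a_i = a_j would force <v, v> = 0. *)
Lemma weight_adj_neq a v i j : j = i.+1 :> nat -> weight a v -> v != 0 ->
  a j - a i != 0.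
Proof.
move=> ji av v0; apply: contraNneq (v0) => aij; apply/eqP/hform_eq0.
have := hform_jmx i (v *m rG (tperm i j)) v.
rewrite -mulmxA (jmx_adj ji) mulmxBr mulmxA mulmx1 !av -scalemxAl.
rewrite hformBl hformZl hformZr (weight_real _ av v0).
rewrite -(subrK (a i) (a j)) aij add0r => /eqP.
by rewrite -subr_eq0 addrAC subrr add0r oppr_eq0 => /eqP.
Qed.

Definition intertwine a i j v := v *m rG (tperm i j) - (a j - a i)^-1 *: v.

(** Since s^2 = 1, (s - 1/r) s = 1 - s/r; writing s as (s - 1/r) + 1/r gives the second formula of
    the seminormal form. *)
Lemma intertwine_tperm a i j v :
  intertwine a i j v *m rG (tperm i j) =
    (1 - ((a j - a i) ^+ 2)^-1) *: v - (a j - a i)^-1 *: intertwine a i j v.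
Proof.
rewrite mulmxBl -mulmxA sn_repr_tpermK mulmx1 -scalemxAl scalerBr scalerA.
by rewrite -invfM -expr2 scalerBl scale1r opprB addrA subrK.
Qed.

Lemma weight_intertwine a i j v : j = i.+1 :> nat -> weight a v -> v != 0 ->
  weight (a \o tperm i j) (intertwine a i j v).
Proof.
move=> ji av v0 k; have r0 := weight_adj_neq ji av v0.
rewrite /intertwine mulmxBl -scalemxAl av -mulmxA /=.
have [->|ki] := eqVneq k i; last have [->|kj] := eqVneq k j.
- rewrite tpermL (jmx_adj ji) mulmxBr mulmx1 mulmxA av -scalemxAl.
  rewrite scalerBr -!addrA; congr (_ + _); rewrite -opprD -[X in X + _]scale1r.
  rewrite !scalerA -scalerDl; congr (- (_ *: _)).
  by field.
- rewrite tpermR (jmx_adj_succ ji) mulmxDr mulmx1 mulmxA av -scalemxAl.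
  rewrite scalerBr -!addrA; congr (_ + _); rewrite -[X in X + _]scale1r.
  rewrite !scalerA -!scaleNr -scalerDl; congr (_ *: _).
  by field.
rewrite tpermD 1?eq_sym // jmx_comm_adj // mulmxA av -scalemxAl scalerBr.
by rewrite !scalerA mulrC.
Qed.

Lemma intertwine_neq0 a i j v : (a j - a i) ^+ 2 != 1 -> v != 0 ->
  intertwine a i j v != 0.
Proof.
move=> r1; apply: contraNneq => u0; have := intertwine_tperm a i j v.
rewrite u0 mul0mx scaler0 subr0 => /esym/eqP; rewrite scaler_eq0 subr_eq0.
by rewrite eq_sym invr_eq1 (negPf r1).
Qed.

(** [u] and [v] differ in the eigenvalue of X_i, so <v, u> = 0. Hence <u, u> = <v s, u> = <v, u s>,
    and for r^2 = 1 the vector u s is a multiple of u. *)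
Lemma intertwine_eq0 a i j v : j = i.+1 :> nat -> weight a v -> v != 0 ->
  (a j - a i) ^+ 2 = 1 -> intertwine a i j v = 0.
Proof.
move=> ji av v0 r1; apply: hform_eq0; set u := intertwine a i j v.
have vu0: hform v u = 0.
  apply: (weight_orth (k := i) av (weight_intertwine ji av v0)).
  by rewrite /= tpermL eq_sym -subr_eq0 (weight_adj_neq ji av v0).
rewrite {1}/u hformBl hformZl vu0 mulr0 subr0 hform_tperm.
rewrite intertwine_tperm r1 invr1 subrr scale0r sub0r -scaleNr hformZr -/u vu0.
by rewrite mulr0.
Qed.

(** The first Jucys-Murphy element is an empty sum. For a later [k] with predecessor [i], either a_k
    = a_i + 1 or a_k = a_i - 1, or the intertwined vector is nonzero with i-th eigenvalue a_k; hence
    the induction runs over all vectors at once. *)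
Lemma weight_int a v k : weight a v -> v != 0 -> exists z : int, a k = z%:~R.
Proof.
have [m] := ubnP k; elim: m => // m IHm in a v k *; rewrite ltnS => km av v0.
have [k0|k_gt0] := posnP k.
  exists 0; apply/eqP; have := av k; rewrite /jmx big1 ?mulmx0 => [/esym/eqP|l].
    by rewrite scaler_eq0 (negPf v0) orbF.
  by rewrite k0.
have lt_in: (k.-1 < n)%N by have := ltn_ord k; lia.
pose i := Ordinal lt_in; have ki: k = i.+1 :> nat by rewrite /= prednK.
have [z az]: exists z : int, a i = z%:~R by apply: IHm av v0; rewrite /=; lia.
have [r1|r1] := eqVneq ((a k - a i) ^+ 2) 1; last first.
  have [|z' az'] :=
    IHm _ _ i _ (weight_intertwine ki av v0) (intertwine_neq0 r1 v0).
    by rewrite /=; lia.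
  by exists z'; rewrite -az' /= tpermL.
have /eqP := r1; rewrite sqrf_eq1 !subr_eq az => /orP[]/eqP->.
  by exists (1 + z); rewrite rmorphD.
by exists (-1 + z); rewrite rmorphD rmorphN.
Qed.

Lemma eq_weight a b v : a =1 b -> weight a v -> weight b v.
Proof. by move=> ab av k; rewrite av ab. Qed.

(** * Admissible permutations *)

Definition near (x : C) := (x == 0) || (x ^+ 2 == 1).

Lemma nearN x : near (- x) = near x.
Proof. by rewrite /near oppr_eq0 sqrrN. Qed.

Definition admissible a (s : 'S_n) :=
  [forall k : 'I_n, forall l : 'I_n,
    (k < l)%N && near (a l - a k) ==> (s k < s l)%N].

Lemma admissibleP a s :
  reflect (forall k l, (k < l)%N -> near (a l - a k) -> (s k < s l)%N)
          (admissible a s).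
Proof.
apply: (iffP 'forall_forallP) => adm k l.
  by move=> kl akl; have /implyP := adm k l; apply; rewrite kl.
by apply/implyP => /andP[]; apply: adm.
Qed.

Lemma admissible1 a : admissible a 1%g.
Proof. by apply/admissibleP => k l; rewrite !perm1. Qed.

Lemma admissible_mul_adj a s i j : j = i.+1 :> nat -> admissible a s ->
  ~~ near (a (s^-1%g j) - a (s^-1%g i)) -> admissible a (s * tperm i j)%g.
Proof.
move=> ji /admissibleP adm_s far; apply/admissibleP => k l kl akl.
have lt_skl := adm_s k l kl akl; rewrite !permM tperm_adj_ltn //.
  by apply: contraNneq far => -[<- <-]; rewrite !permK.
by apply/eqP => -[sk sl]; move: lt_skl; rewrite sk sl; lia.
Qed.

Lemma admissible_far a s i j : j = i.+1 :> nat ->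
    (s^-1%g i < s^-1%g j)%N -> admissible a (s * tperm i j)%g ->
  ~~ near (a (s^-1%g j) - a (s^-1%g i)).
Proof.
move=> ji lt_ij /admissibleP adm; apply/negP => /(adm _ _ lt_ij).
by rewrite !permM !permKV tpermL tpermR; lia.
Qed.

Lemma mul_tpermV s i j k : (s * tperm i j)^-1%g k = s^-1%g (tperm i j k).
Proof. by rewrite invMg tpermV permM. Qed.

Lemma admissible_descent a s i j : j = i.+1 :> nat ->
    (s^-1%g i < s^-1%g j)%N -> admissible a (s * tperm i j)%g ->
  admissible a s.
Proof.
move=> ji lt_ij adm; rewrite -[s]mulg1 -(tperm2 i j) mulgA.
apply: admissible_mul_adj => //; rewrite !mul_tpermV tpermL tpermR -nearN opprB.
exact: admissible_far adm.
Qed.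

(** The permutation [u] preserves [a]. As [s] and [t] keep the order of positions with equal values
    of [a], [u] is increasing on each level set of [a], hence trivial. *)
Lemma admissible_inj a s t : admissible a s -> admissible a t ->
  (forall k, a (s^-1%g k) = a (t^-1%g k)) -> s = t.
Proof.
move=> /admissibleP adm_s /admissibleP adm_t ast.
pose u := (s * t^-1)%g; suff u1: u = 1%g by rewrite -[s](mulgKV t) -/u u1 mul1g.
have au k: a (u k) = a k by rewrite permM -ast permK.
have near0 k l: a k = a l -> near (a l - a k).
  by move=> ->; rewrite /near subrr eqxx.
have u_mono k l: a k = a l -> (k < l)%N -> (u k < u l)%N.
  move=> akl lt_kl; have lt_s := adm_s k l lt_kl (near0 _ _ akl).
  have ne_u: u k != u l by rewrite (inj_eq perm_inj) -val_eqE /=; lia.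
  rewrite ltnNge leq_eqVlt eq_sym (negPf ne_u : (u k == u l :> nat) = false) /=.
  apply/negP => lt_u; have := adm_t _ _ lt_u; rewrite !au akl near0 //.
  by rewrite !permM !permKV => /(_ isT); lia.
(* Once [u] fixes everything below [k], neither [u k] nor [u^-1 k] lies below [k]; and [u^-1 k]
   above [k] contradicts monotonicity on the level set. *)
apply/permP => k; rewrite perm1; have [m] := ubnP k.
elim: m k => // m IHm k; rewrite ltnS => km.
have [lt_uk|lt_ku|/val_inj//] := ltngtP (u k) k.
  by apply: (@perm_inj _ u); apply: IHm; lia.
have ap: a (u^-1%g k) = a k by rewrite -au permKV.
have [lt_pk|lt_kp|/val_inj pk] := ltngtP (u^-1%g k) k.
- have := IHm _ (leq_trans lt_pk km); rewrite permKV => kp.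
  by move: lt_pk; rewrite -kp ltnn.
- by have := u_mono _ _ (esym ap) lt_kp; rewrite permKV; lia.
by rewrite -{1}pk permKV.
Qed.

Lemma admissible_orth a s t u v :
    admissible a s -> admissible a t -> s != t ->
    weight (fun k => a (s^-1%g k)) u -> weight (fun k => a (t^-1%g k)) v ->
  hform u v = 0.
Proof.
move=> adm_s adm_t st wu wv.
have [/existsP[k ak]|] := boolP [exists k, a (s^-1%g k) != a (t^-1%g k)].
  exact: weight_orth wu wv ak.
rewrite negb_exists => /forallP eq_a; case/eqP: st.
apply: (admissible_inj adm_s adm_t) => k.
by apply/eqP; rewrite -[_ == _]negbK eq_a.
Qed.

Lemma orth_indep (I : finType) (x : I -> 'rV[C]_d) (c : I -> C) :
    (forall i : I, x i != 0) ->
    (forall i j : I, i != j -> hform (x i) (x j) = 0) ->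
  \sum_i c i *: x i = 0 -> forall i : I, c i = 0.
Proof.
move=> x0 xx cx0 i; have := hform0l (x i).
rewrite -cx0 hform_suml (bigD1 i) //=.
rewrite big1 => [|j /xx ji]; last by rewrite hformZl ji mulr0.
rewrite addr0 hformZl => /eqP; rewrite mulf_eq0 => /orP[/eqP//|/eqP/hform_eq0].
by move/eqP; rewrite (negPf (x0 i)).
Qed.

(** * The seminormal family generated by one eigenvector *)

Section SeminormalFamily.

Variables (a : 'I_n -> C) (w0 : 'rV[C]_d).
Hypotheses (w0_neq0 : w0 != 0) (w0_weight : weight a w0).

Local Notation wt s := (fun k => a (s^-1%g k)).

Definition below (m : nat) y :=
  forall t, (inversions t < m)%N -> hform (w0 *m rG t) y = 0.

(* Without naming subspaces: [v - w0 s] lies in the span of the [w0 t] with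
   fewer inversions than [s], this span being described as a biorthogonal. *)
Definition leading s v :=
  forall y, below (inversions s) y -> hform v y = hform (w0 *m rG s) y.

(** The term v/r pairs to 0 with [y], which is orthogonal to [w0 s] and to all shorter [w0 t]. In
    the other term the transposition moves over to [y]; it lengthens a permutation by at most one,
    so the moved [y] is still orthogonal to what is shorter than [s]. *)
Lemma leading_intertwine s i j v : j = i.+1 :> nat ->
    (s^-1%g i < s^-1%g j)%N -> leading s v ->
  leading (s * tperm i j)%g (intertwine (wt s) i j v).
Proof.
move=> ji lt_ij lead_v y; rewrite inversions_mul_adj // => below_y.
have below_s: below (inversions s) y.
  by move=> t lt_t; apply: below_y; apply: ltnW.
rewrite hformBl hformZl hform_tperm sn_repr_mxM mulmxA hform_tperm.
rewrite (lead_v y below_s) (below_y s (ltnSn _)) mulr0 subr0.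
apply: lead_v => t lt_t; rewrite -hform_tperm -mulmxA -sn_repr_mxM.
by apply: below_y; have := inversions_mul_adj_le t ji; lia.
Qed.

Lemma intertwine_admissible s i j v : j = i.+1 :> nat ->
    (s^-1%g i < s^-1%g j)%N -> admissible a (s * tperm i j)%g ->
    weight (wt s) v -> v != 0 ->
  weight (wt (s * tperm i j)%g) (intertwine (wt s) i j v)
  /\ intertwine (wt s) i j v != 0.
Proof.
move=> ji lt_ij adm wv v0; split.
  apply: eq_weight (weight_intertwine ji wv v0) => k /=.
  by rewrite mul_tpermV.
apply: intertwine_neq0 v0.
by have := admissible_far ji lt_ij adm; rewrite negb_or => /andP[].
Qed.

(** A single path of ascents is followed; independence of the path is the content of
    [intertwine_unique]. *)
Lemma exists_leading s : admissible a s ->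
  exists v, [/\ v != 0, weight (wt s) v & leading s v].
Proof.
have [m] := ubnP (inversions s); elim: m s => // m IHm s lt_s adm_s.
have [->|s_neq1] := eqVneq s 1%g.
  exists w0; split=> // [|y _]; last by rewrite repr_mx1 mulmx1.
  by apply: eq_weight w0_weight => k; rewrite invg1 perm1.
have [s' [i [j [ji lt_ij s_def inv_s]]]] := perm_ascent_split s_neq1.
move: adm_s; rewrite s_def => adm_s.
have [|v [v0 wv lead_v]] := IHm s' _ (admissible_descent ji lt_ij adm_s).
  by rewrite inv_s in lt_s.
have [wu u0] := intertwine_admissible ji lt_ij adm_s wv v0.
by exists (intertwine (wt s') i j v); split=> //; apply: leading_intertwine.
Qed.

(** The relations between [v s] and its neighbour are premises, so that the lemma applies inside the
    induction of [leading_separating], before they are known everywhere. The clause on [q1] keeps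
    values of [v] at inadmissible permutations out of later sums. *)
Lemma adj_action (v : 'S_n -> 'rV[C]_d) s i j : j = i.+1 :> nat ->
    admissible a s -> v s != 0 -> weight (wt s) (v s) ->
    ((s^-1%g i < s^-1%g j)%N -> admissible a (s * tperm i j)%g ->
      v (s * tperm i j)%g = intertwine (wt s) i j (v s)) ->
    ((s^-1%g j < s^-1%g i)%N -> admissible a (s * tperm i j)%g ->
      v s = intertwine (wt (s * tperm i j)%g) i j (v (s * tperm i j)%g)) ->
  exists q1 q2 : rat,
    v s *m rG (tperm i j) =
      ratr q1 *: v (s * tperm i j)%g + ratr q2 *: v s
    /\ (q1 != 0 -> admissible a (s * tperm i j)%g).
Proof.
move=> ji adm_s v0 wv asc desc; set v' := v (s * tperm i j)%g.
pose r := a (s^-1%g j) - a (s^-1%g i).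
have [q rq]: exists q : rat, r = ratr q.
  have [z1 az1] := weight_int (s^-1%g i) w0_weight w0_neq0.
  have [z2 az2] := weight_int (s^-1%g j) w0_weight w0_neq0.
  by exists (z2 - z1)%:~R; rewrite ratr_int rmorphB /= -az1 -az2.
have [near_r|far_r] := boolP (near r).
  (* As [v s] is nonzero, r is not 0; so r is 1 or -1, the intertwined vector vanishes, and the
     transposition acts by 1/r. *)
  exists 0, q^-1; rewrite eqxx; split=> //.
  have r1: r ^+ 2 = 1.
    have r0 := weight_adj_neq ji wv v0.
    by move: near_r; rewrite /near (negPf r0) => /eqP.
  have /eqP := intertwine_eq0 ji wv v0 r1; rewrite subr_eq0 => /eqP->.
  by rewrite rmorph0 scale0r add0r fmorphV /= -rq.
have adm' := admissible_mul_adj ji adm_s far_r.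
have [lt_ij|lt_ji|/val_inj/perm_inj ij] := ltngtP (s^-1%g i) (s^-1%g j).
- exists 1, q^-1; split=> //; rewrite /v' asc //.
  by rewrite rmorph1 scale1r fmorphV /= -rq subrK.
(* Here [v s] is the upper vector of the pair; seen from the lower one the difference of eigenvalues
   is -r. *)
- exists (1 - (q ^+ 2)^-1), q^-1; split=> //.
  rewrite {1}desc // intertwine_tperm -desc // !mul_tpermV tpermL tpermR.
  rewrite -[a (s^-1%g i) - _]opprB -/r sqrrN invrN scaleNr opprK.
  by rewrite rmorphB rmorph1 !fmorphV /= rmorphXn /= -rq.
by move: ji; rewrite ij; lia.
Qed.

(** Expresses by orthogonality that the span of the admissible [v t] with fewer than [m] inversions
    contains every [w0 t] with fewer than [m] inversions. *)
Definition separating (v : 'S_n -> 'rV[C]_d) (m : nat) :=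
  forall y, (forall t, admissible a t -> (inversions t < m)%N ->
               hform (v t) y = 0) -> below m y.

(** Both sides have the same eigenvalues and the same leading term. The eigenvalues make their
    difference orthogonal to all shorter admissible [v t], hence by separation to all shorter
    [w0 t]; pairing the difference with itself, the leading terms then cancel. *)
Lemma intertwine_unique (v : 'S_n -> 'rV[C]_d) s i j : j = i.+1 :> nat ->
    (forall t, admissible a t ->
       [/\ v t != 0, weight (wt t) (v t) & leading t (v t)]) ->
    separating v (inversions (s * tperm i j)%g) ->
    (s^-1%g i < s^-1%g j)%N -> admissible a (s * tperm i j)%g ->
  v (s * tperm i j)%g = intertwine (wt s) i j (v s).
Proof.
move=> ji vP sep lt_ij adm.
have [v0 wv lead_v] := vP s (admissible_descent ji lt_ij adm).
have [v'0 wv' lead_v'] := vP _ adm.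
have [wu _] := intertwine_admissible ji lt_ij adm wv v0.
have lead_u := leading_intertwine ji lt_ij lead_v.
set x := v _; set u := intertwine _ _ _ _.
have wxu: weight (wt (s * tperm i j)%g) (x - u).
  by move=> k; rewrite mulmxBl wv' wu [RHS]scalerBr.
suff xu0: below (inversions (s * tperm i j)%g) (x - u).
  apply/eqP; rewrite -subr_eq0; apply/eqP/hform_eq0.
  by rewrite hformBl lead_v' // lead_u // subrr.
apply: sep => t adm_t lt_t; have [_ wvt _] := vP t adm_t.
apply: admissible_orth adm_t adm _ wvt wxu.
by apply: contraTneq lt_t => ->; rewrite ltnn.
Qed.

(** Strong induction on [m]. For s = s' (i j), <w0 s, y> = <w0 s', y (i j)>. By the case
    [inversions s] it suffices that y (i j) is orthogonal to each [v t] shorter than [s], and (i j)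
    sends [v t] to a combination of two vectors orthogonal to [y]. *)
Lemma leading_separating (v : 'S_n -> 'rV[C]_d) m :
    (forall t, admissible a t ->
       [/\ v t != 0, weight (wt t) (v t) & leading t (v t)]) ->
  separating v m.
Proof.
move=> vP; have [m'] := ubnP m; elim: m' m => // m' IHm m; rewrite ltnS => le_m.
move=> y v_y s lt_s; have [->|s_neq1] := eqVneq s 1%g.
  have [_ _ lead1] := vP _ (admissible1 a); rewrite -lead1 ?v_y ?admissible1 //.
    by rewrite inversions1; lia.
  by move=> t; rewrite inversions1.
have [s' [i [j [ji lt_ij s_def inv_s]]]] := perm_ascent_split s_neq1.
rewrite s_def sn_repr_mxM mulmxA hform_tperm.
have: below (inversions s) (y *m rG (tperm i j)); last by apply; lia.
have sep_s: separating v (inversions s) by apply: IHm; lia.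
apply: sep_s => t adm_t lt_t.
have [v0 wv _] := vP t adm_t; have le_t := inversions_mul_adj_le t ji.
have [||q1 [q2 [vE adm_q1]]] := adj_action ji adm_t v0 wv.
- by move=> lt adm; apply: intertwine_unique => //; apply: IHm; lia.
- set t' := (t * tperm i j)%g => lt adm.
  have tE: t = (t' * tperm i j)%g by rewrite -mulgA tperm2 mulg1.
  have lt': (t'^-1%g i < t'^-1%g j)%N by rewrite !mul_tpermV tpermL tpermR.
  rewrite {1}tE; apply: intertwine_unique; rewrite -?tE //.
  by apply: IHm; lia.
rewrite -hform_tperm vE hformDl !hformZl (v_y t) //; last by lia.
rewrite mulr0 addr0; have [->|/adm_q1 adm'] := eqVneq q1 0.
  by rewrite rmorph0 mul0r.
by rewrite v_y ?mulr0 //; lia.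
Qed.

Lemma seminormal_family : exists v : 'S_n -> 'rV[C]_d,
  forall s, admissible a s ->
    [/\ v s != 0, weight (wt s) (v s) &
        forall i j, j = i.+1 :> nat ->
          (s^-1%g i < s^-1%g j)%N -> admissible a (s * tperm i j)%g ->
          v (s * tperm i j)%g = intertwine (wt s) i j (v s)].
Proof.
have /fin_all_exists[v vP] s : exists v, admissible a s ->
    [/\ v != 0, weight (wt s) v & leading s v].
  have [/exists_leading[v vP]|] := boolP (admissible a s); first by exists v.
  (* Default value at inadmissible permutations. *)
  by exists 0.
exists v => s adm_s; have [v0 wv _] := vP s adm_s; split=> // i j ji lt_ij adm.
exact/intertwine_unique/adm/lt_ij/leading_separating.
Qed.

Lemma seminormal_action : exists v : 'S_n -> 'rV[C]_d,
  (forall s, admissible a s ->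
     v s != 0 /\ weight (wt s) (v s)) /\
  forall s i j, admissible a s -> j = i.+1 :> nat ->
    exists q1 q2 : rat,
      v s *m rG (tperm i j) =
        ratr q1 *: v (s * tperm i j)%g + ratr q2 *: v s
      /\ (q1 != 0 -> admissible a (s * tperm i j)%g).
Proof.
have [v vP] := seminormal_family; exists v; split=> [s /vP[]//|s i j adm_s ji].
have [v0 wv up] := vP s adm_s; apply: adj_action => // [|lt_ji adm'].
  exact: up.
have [_ _ up'] := vP _ adm'; rewrite -{1}[s]mulg1 -(tperm2 i j) mulgA up' //.
  by rewrite !mul_tpermV tpermL tpermR.
by rewrite -mulgA tperm2 mulg1.
Qed.

End SeminormalFamily.

End WeightVectors.

(** * Rationality of the irreducible representations *)

Section Rationality.

Variables (C : numClosedFieldType) (n d : nat).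
Variable rG : mx_representation C [set: 'S_n] d.

Lemma exists_weight : (0 < d)%N ->
  exists a w, w != 0 /\ weight rG a w.
Proof.
move=> d_gt0; have [|w w0 /allP wP] :=
  @common_eigenvector _ _ [seq jmx rG k | k : 'I_n] d_gt0.
  by move=> A B /mapP[k _ ->] /mapP[l _ ->]; apply: jmx_commC.
have /fin_all_exists[a aP] k : exists c, w *m jmx rG k = c *: w.
  by apply/sub_rVP/wP/map_f; rewrite mem_enum.
by exists a, w.
Qed.

(** The rational matrices are determined by [rG] because [V] is row free, hence multiplicative. The
    equation [m = d] is a premise because the basis will be indexed by admissible permutations,
    whose number is computed only afterwards. *)
Lemma rational_basis_defined_over_rat m (V : 'M[C]_(m, d)) : m = d ->
    row_free V ->
    (forall g, exists A : 'M[rat]_m, V *m rG g = map_mx ratr A *m V) ->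
  defined_over_rat rG.
Proof.
move=> md; subst m => freeV /fin_all_exists[A VA].
have A_repr : mx_repr [set: 'S_n] A.
  split=> [|g h _ _]; apply: (@map_mx_inj _ _ (ratr : {rmorphism rat -> C}));
    apply: (row_free_inj freeV).
    by rewrite -VA repr_mx1 mulmx1 map_mx1 mul1mx.
  by rewrite -VA sn_repr_mxM mulmxA VA map_mxM -!mulmxA VA.
exists (MxRepresentation A_repr); apply/mx_rsim_sym.
by exists V => // g _; rewrite VA.
Qed.

Lemma irr_defined_over_rat : mx_irreducible rG -> defined_over_rat rG.
Proof.
move=> /mx_irrP[d_gt0 irr]; have [a [w0 [w0_neq0 w0P]]] := exists_weight d_gt0.
have [v [vP vS]] := seminormal_action w0_neq0 w0P.
pose N := #|admissible a|.
pose V : 'M[C]_(N, d) := \matrix_i v (enum_val i).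
have rowV i : row i V = v (enum_val i) by rewrite rowK.
have vV s : admissible a s -> exists w : 'rV[rat]_N, v s = map_mx ratr w *m V.
  move=> adm_s; exists (delta_mx 0 (enum_rank_in adm_s s)).
  by rewrite map_delta_mx -rowE rowV enum_rankK_in.
have adjV (i j : 'I_n) : j = i.+1 :> nat ->
    exists A : 'M[rat]_N, V *m rG (tperm i j) = map_mx ratr A *m V.
  move=> ji.
  have /fin_all_exists[A AP] k : exists w : 'rV[rat]_N,
      row k V *m rG (tperm i j) = map_mx ratr w *m V.
    have adm_k : admissible a (enum_val k) by exact: (enum_valP k).
    have [q1 [q2 [vE adm_q1]]] := vS _ _ _ adm_k ji.
    have [u uE] := vV _ adm_k.
    (* If [q1] is 0 the neighbour may be inadmissible and its vector no row of [V]; zero coordinates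
       then serve. *)
    have [u' u'E] : exists u' : 'rV[rat]_N,
        ratr q1 *: v (enum_val k * tperm i j)%g = map_mx ratr u' *m V.
      have [->|/adm_q1/vV[u' u'E]] := eqVneq q1 0.
        by exists 0; rewrite map_mx0 mul0mx rmorph0 scale0r.
      by exists (q1 *: u'); rewrite map_mxZ -scalemxAl -u'E.
    exists (u' + q2 *: u).
    by rewrite rowV vE map_mxD map_mxZ mulmxDl -scalemxAl -uE -u'E.
  exists (\matrix_k A k); apply/row_matrixP=> k.
  by rewrite !row_mul AP -map_row rowK.
have VP g : exists A : 'M[rat]_N, V *m rG g = map_mx ratr A *m V.
  elim/adj_ind: g => [|g i j /adjV[A' A'P] [A AP]].
    by exists 1%:M; rewrite repr_mx1 mulmx1 map_mx1 mul1mx.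
  by exists (A *m A'); rewrite sn_repr_mxM mulmxA AP -mulmxA A'P mulmxA map_mxM.
have freeV : row_free V.
  apply: inj_row_free => c; rewrite mulmx_sum_row => cV; apply/rowP=> i.
  rewrite mxE; apply: (orth_indep (c := c 0) (x := fun i => row i V)) cV i => i.
    by rewrite rowV; have [] := vP _ (enum_valP i).
  move=> j ij; rewrite !rowV.
  have [[_ wi] [_ wj]] := (vP _ (enum_valP i), vP _ (enum_valP j)).
  apply: admissible_orth (enum_valP i) (enum_valP j) _ wi wj.
  by rewrite (inj_eq enum_val_inj).
apply: (rational_basis_defined_over_rat _ freeV VP).
(* The row space of [V] is a nonzero submodule, hence everything; with freeness this gives
   [N = d]. *)
have fullV : row_full V.
  rewrite -(eq_row_full (genmxE V)); apply: irr.
    apply/mxmoduleP=> g _; have [A VA] := VP g.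
    by rewrite (eqmxMr _ (genmxE V)) genmxE VA submxMl.
  rewrite -mxrank_eq0 genmxE (eqP freeV) -lt0n; apply/card_gt0P.
  by exists 1%g; apply: admissible1.
by rewrite -(eqP freeV) (eqP fullV).
Qed.

End Rationality.

(** * Standard tableaux give admissible permutations *)

Section Tableaux.

Variables (n : nat) (lam : partition_of n).
Implicit Types (T : stdtab lam) (b : box lam).

Lemma row_tab_leq b1 b2 : (val (row_tab lam) b1 < val (row_tab lam) b2)%N ->
  (brow b1 < brow b2)%N \/ brow b1 = brow b2 /\ (bcol b1 < bcol b2)%N.
Proof.
rewrite /= !ffunE /= ltnNge (reshape_leq lam).
rewrite !flatten_indexKl ?flatten_indexKr ?bcol_lt //; lia.
Qed.

(** If [b1] is in an earlier row, the bound on contents forbids it to lie to the right of [b2]. So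
    [T] increases from [b1] down its column to the corner [b3] in the row of [b2], then along that
    row to [b2]. *)
Lemma stdtab_lt T b1 b2 : (val (row_tab lam) b1 < val (row_tab lam) b2)%N ->
  `|content b2 - content b1| <= 1 -> (val T b1 < val T b2)%N.
Proof.
move=> /row_tab_leq; case/and3P: (valP T) => _ /'forall_forallP rowT.
move/'forall_forallP=> colT; rewrite /content => b12 near_b.
have row_lt c1 c2 : brow c1 = brow c2 -> (bcol c1 < bcol c2)%N ->
    (val T c1 < val T c2)%N.
  by move=> rc cc; have /implyP := rowT c1 c2; apply; rewrite rc eqxx.
have col_lt c1 c2 : bcol c1 = bcol c2 -> (brow c1 < brow c2)%N ->
    (val T c1 < val T c2)%N.
  by move=> cc rc; have /implyP := colT c1 c2; apply; rewrite cc eqxx.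
case: b12 => [lt_r|[eq_r lt_c]]; last exact: row_lt.
have le_c: (bcol b1 <= bcol b2)%N by lia.
have lt_b3: (bcol b1 < nth 0 lam (tag b2))%N := leq_ltn_trans le_c (bcol_lt b2).
pose b3 : box lam :=
  Tagged (fun r : 'I_(size lam) => 'I_(nth 0 lam r)) (Ordinal lt_b3).
have lt13: (val T b1 < val T b3)%N by apply: col_lt.
have [lt_c|ge_c] := ltnP (bcol b1) (bcol b2).
  by apply: ltn_trans lt13 (row_lt b3 b2 _ lt_c).
by rewrite -(@box_inj _ _ b3 b2) //= /bcol /=; apply/eqP; rewrite eqn_leq le_c.
Qed.

Lemma tab_perm_injective : injective (@tab_perm n lam).
Proof.
move=> T T' eqT; apply/val_inj/ffunP => b.
by rewrite -(tab_permE T) -(tab_permE T') eqT.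
Qed.

Lemma tab_content_perm T k :
  tab_content T (tab_perm T k) = tab_content (row_tab lam) k.
Proof. by rewrite /tab_content permE stdtabK. Qed.

Lemma tab_perm_swap T T' i j : val T' = swap_fill i j (val T) ->
  tab_perm T' = (tab_perm T * tperm i j)%g.
Proof.
move=> T'E; apply/permP=> k; rewrite -[k](box_ofK (row_tab lam)).
by rewrite permM !tab_permE T'E ffunE.
Qed.

Lemma admissible_tab_perm (C : numClosedFieldType) T :
  admissible (fun k => (tab_content (row_tab lam) k)%:~R : C) (tab_perm T).
Proof.
apply/admissibleP => k l kl near_kl.
rewrite -[k](box_ofK (row_tab lam)) -[l](box_ofK (row_tab lam)) !tab_permE.
apply: stdtab_lt; rewrite ?box_ofK //; move: near_kl.
rewrite /near /tab_content -rmorphB -rmorphXn /= intr_eq0.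
rewrite -[1]/(1%:~R) eqr_int sqrf_eq1.
by case/or3P => /eqP->.
Qed.

End Tableaux.

(** * The seminormal basis indexed by standard tableaux *)

Section SeminormalBasis.

Variables (C : numClosedFieldType) (n d : nat) (lam : partition_of n).
Variable rG : mx_representation C [set: 'S_n] d.

Lemma seminormal_basis (w : stdtab lam -> 'rV[C]_d) :
    tab_basis w ->
    (forall T j, sn_act_JM rG j (w T) = (tab_content T j)%:~R *: w T) ->
  exists v : stdtab lam -> 'rV[C]_d,
    tab_basis v /\
    forall (i j : 'I_n) (T T' : stdtab lam),
      j = i.+1 :> nat -> val T' = swap_fill i j (val T) ->
      (tab_length T < tab_length T')%N ->
      let r : C := (tab_content T j - tab_content T i)%:~R in
      sn_act rG (tperm i j) (v T) = v T' + r^-1 *: v T /\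
      sn_act rG (tperm i j) (v T') = (1 - (r ^+ 2)^-1) *: v T - r^-1 *: v T'.
Proof.
move=> basis_w wP; pose T0 := row_tab lam.
pose a (k : 'I_n) : C := (tab_content T0 k)%:~R.
have w0_neq0: w T0 != 0 by apply: (basis_not0 basis_w); apply: codom_f.
have w0_weight: weight rG a (w T0).
  by move=> k; rewrite -sn_act_JME wP.
have [v vP] := seminormal_family w0_neq0 w0_weight.
pose s (T : stdtab lam) := tab_perm T.
have adm T : admissible a (s T) by apply: admissible_tab_perm.
(* Thus the family member at [s T] has the content sequence of [T] as eigenvalues. *)
have aE T k : a ((s T)^-1%g k) = (tab_content T k)%:~R.
  by rewrite /a -(tab_content_perm T) permKV.
exists (v \o s); split.
  (* The vectors are nonzero and pairwise orthogonal, hence free, and there are as many as in the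
     basis [w]. *)
  rewrite /tab_basis basisEfree subvf size_codom (size_basis basis_w).
  rewrite leqnn !andbT.
  apply/(@freeP _ _ _ (codom_tuple (v \o s))) => c cv.
  apply: (orth_indep (rG := rG)) cv => [i|i j ij].
    by rewrite nth_codom; have [] := vP _ (adm (enum_val i)).
  rewrite !nth_codom /=.
  have [_ wi _] := vP _ (adm (enum_val i)).
  have [_ wj _] := vP _ (adm (enum_val j)).
  apply: admissible_orth (adm _) (adm _) _ wi wj.
  by rewrite (inj_eq (@tab_perm_injective _ _)) (inj_eq enum_val_inj).
move=> i j T T' ji /tab_perm_swap sT' lt_l r.
(* Otherwise [T] would arise from [T'] by an ascent and be the longer of the two. *)
have lt_ij: ((s T)^-1%g i < (s T)^-1%g j)%N.
  have [//|lt_ji|/val_inj/perm_inj ij] := ltngtP ((s T)^-1%g i) ((s T)^-1%g j).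
    move: lt_l; rewrite /tab_length sT'.
    have {1}->: tab_perm T = (s T * tperm i j * tperm i j)%g.
      by rewrite -mulgA tperm2 mulg1.
    rewrite inversions_mul_adj ?mul_tpermV ?tpermL ?tpermR //.
    by rewrite /s; lia.
  by move: ji; rewrite ij; lia.
have [_ _ up] := vP _ (adm T).
have adm' := adm T'; rewrite /s sT' in adm'.
have vT' : v (s T') = intertwine rG (fun k => a ((s T)^-1%g k)) i j (v (s T)).
  by rewrite {1}/s sT'; apply: up.
have rE : r = a ((s T)^-1%g j) - a ((s T)^-1%g i) by rewrite !aE -rmorphB.
rewrite /sn_act /= vT' intertwine_tperm -rE; split=> //.
by rewrite /intertwine -rE subrK.
Qed.

End SeminormalBasis.

Theorem proposition6p1 (R : realType) (n : nat) :
  (forall (lam : partition_of n) (d : nat)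
          (rG : mx_representation R[i] [set: 'S_n] d),
     is_V rG lam ->
     exists v : stdtab lam -> 'rV[R[i]]_d,
       tab_basis v /\
       forall (i j : 'I_n) (T T' : stdtab lam),
         j = i.+1 :> nat ->
         val T' = swap_fill i j (val T) ->
         (tab_length T < tab_length T')%N ->
         let r : R[i] := (tab_content T j - tab_content T i)%:~R in
         sn_act rG (tperm i j) (v T) = v T' + r^-1 *: v T /\
         sn_act rG (tperm i j) (v T') = (1 - (r ^+ 2)^-1) *: v T - r^-1 *: v T')
  /\
  (forall (d : nat) (rG : mx_representation R[i] [set: 'S_n] d),
     mx_irreducible rG -> defined_over_rat rG).
Proof.
split=> [lam d rG [_ [w [basis_w wP]]]|d rG]; last exact: irr_defined_over_rat.
exact: seminormal_basis basis_w wP.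
Qed.
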